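(* Let $M\subset\mathbb{R}^4$ be the corank $1$ surface at $p=0$ locally parametrised by $$f(x,y)=\left(x,\ xy+h(y),\ \sum_{i+j=2,3}b_{ij}x^iy^j,\ c_{20}x^2+\sum_{i+j=3}c_{ij}x^iy^j\right)+o(4),$$ with $b_{ij},c_{ij}\in\mathbb{R}$, $b_{02}c_{03}\neq0$ and $h$ of order at least $4$. Let $v=(0,v_2,0,0)\in\mathbb{S}^3$ with $v_2\neq 0$, let $\Gamma_v$ be the hyperplane through $p$ orthogonal to $v$, and let $h_v(x,y)=\langle f(x,y),v\rangle$. Then $\Gamma_v$ contains the tangent cone $C_pM$ and is transversal to $E_p$, and the height function $h_v$ has a singularity of type $A_1$ at the origin, which is described by the contact of the zero fibre of the submersion $g_3=Y$ with the model surface $\mathtt{X}$.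
   Context: Coordinates in $\mathbb{R}^4$ are $(X,Y,Z,W)$; $o(4)$ is a remainder whose components have order at least $4$ in $(x,y)$. $\mathtt{X}$ is the surface parametrised by $(x,y)\mapsto(x,xy,y^2,y^3)$. The contact of the zero fibre of a submersion $g$ with $\mathtt{X}$ is given by the singularity type at the origin of the composition $g(x,xy,y^2,y^3)$. A singularity of type $A_1$ is a nondegenerate (Morse) critical point. $T_pM$ is the image of $df_0$ (the $X$-axis) and $N_pM$ its orthogonal complement. Let $II$ be the second fundamental form at $p$: the symmetric bilinear map on $\mathbb{R}^2$ given by the second derivatives $f_{xx},f_{xy},f_{yy}$ at $0$ projected orthogonally to $N_pM$. $E_p\subset N_pM$ is the vector plane parallel to the affine plane containing the curvature parabola $\Delta_p=\{II(\mathbf u,\mathbf u):|df_0(\mathbf u)|=1\}$; here $E_p$ is the $YZ$-plane. $C_pM$ denotes the tangent cone of $M$ at $p$, taken in the paper to be the $XZ$-plane. *)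

(* Defs.v *)
From HB Require Import structures.
From mathcomp Require Import all_boot all_order all_algebra.
From mathcomp Require Import all_classical all_reals all_analysis.

Set Implicit Arguments.
Unset Strict Implicit.
Unset Printing Implicit Defensive.

Import Order.TTheory GRing.Theory Num.Theory.
Import numFieldNormedType.Exports.

Local Open Scope classical_set_scope.
Local Open Scope ring_scope.

(* The norm that the library puts on 'rV[R]_n is the sup norm; everything
   metric below uses the Euclidean structure given by dot. *)
Definition dot (R : realType) (n : nat) (u w : 'rV[R]_n) : R :=
  \sum_(i < n) u 0 i * w 0 i.

Definition enorm (R : realType) (n : nat) (u : 'rV[R]_n) : R :=
  Num.sqrt (dot u u).

Definition vec4 (R : realType) (a b c d : R) : 'rV[R]_4 :=
  \row_(i < 4) [:: a; b; c; d]`_i.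

(** ** Smooth germs at the origin *)

(* dpart [:: i1; ...; ik] F is the iterated partial derivative
   d_i1 (... (d_ik F)). *)
Definition dpart (R : realType) (n : nat) (V : normedModType R)
    (s : seq 'I_n.+1) (F : 'rV[R]_n.+1 -> V) : 'rV[R]_n.+1 -> V :=
  foldr (fun i (G : 'rV[R]_n.+1 -> V) => 'D_(delta_mx 0 i) G) F s.

(* F is C^oo on a neighbourhood of 0. *)
Definition smooth_germ (R : realType) (n : nat) (V : normedModType R)
    (F : 'rV[R]_n.+1 -> V) : Prop :=
  exists2 U : set 'rV[R]_n.+1, nbhs (0 : 'rV[R]_n.+1) U &
    forall (s : seq 'I_n.+1) (q : 'rV[R]_n.+1), U q ->
      differentiable (dpart s F) q.

Definition order_ge (R : realType) (n : nat) (V : normedModType R)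
    (k : nat) (F : 'rV[R]_n.+1 -> V) : Prop :=
  forall s : seq 'I_n.+1, (size s < k)%N -> dpart s F 0 = 0.

Definition smooth_germ1 (R : realType) (h : R -> R) : Prop :=
  exists2 U : set R, nbhs (0 : R) U &
    forall (k : nat) (t : R), U t -> derivable (derive1n k h) t 1.

Definition order_ge1 (R : realType) (k : nat) (h : R -> R) : Prop :=
  forall j : nat, (j < k)%N -> derive1n j h 0 = 0.

(** ** Linear subspaces, as sets *)

Definition lin_span (R : realType) (V : lmodType R) (A : set V) : set V :=
  [set w | exists (k : nat) (a : 'I_k -> R) (x : 'I_k -> V),
     (forall i, A (x i)) /\ w = \sum_(i < k) a i *: x i].

(* The vector subspace parallel to the affine hull of A. *)
Definition direction (R : realType) (V : lmodType R) (A : set V) : set V :=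
  lin_span [set w | exists a b, [/\ A a, A b & w = a - b]].

Definition orth_compl (R : realType) (n : nat) (A : set 'rV[R]_n) :
    set 'rV[R]_n :=
  [set w | forall t, A t -> dot w t = 0].

Definition orth_proj (R : realType) (n : nat) (N : set 'rV[R]_n)
    (w : 'rV[R]_n) : 'rV[R]_n :=
  xget 0 [set m | N m /\ orth_compl N (w - m)].

Definition transverse (R : realType) (V : lmodType R) (A B : set V) : Prop :=
  forall w : V, exists a b : V, [/\ A a, B b & w = a + b].

Definition hyperplane (R : realType) (v : 'rV[R]_4) : set 'rV[R]_4 :=
  [set w | dot w v = 0].

Definition XZ_plane (R : realType) : set 'rV[R]_4 :=
  [set w | exists a b : R, w = vec4 a 0 b 0].

Definition YZ_plane (R : realType) : set 'rV[R]_4 :=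
  [set w | exists a b : R, w = vec4 0 a b 0].

(** ** Geometry at the origin of a parametrised surface in R^4 *)

Section SurfaceGerm.
Variables (R : realType) (f : 'rV[R]_2 -> 'rV[R]_4).

Definition tangent_space : set 'rV[R]_4 := range ('d f (0 : 'rV[R]_2)).

Definition normal_space : set 'rV[R]_4 := orth_compl tangent_space.

Definition second_form (u w : 'rV[R]_2) : 'rV[R]_4 :=
  orth_proj normal_space
    (\sum_(i < 2) \sum_(j < 2) (u 0 i * w 0 j) *: dpart [:: i; j] f 0).

Definition curvature_parabola : set 'rV[R]_4 :=
  [set second_form u u
     | u in [set u : 'rV[R]_2 | enorm ('d f (0 : 'rV[R]_2) u) = 1]].

Definition E_plane : set 'rV[R]_4 := direction curvature_parabola.

(* Limits of secants through f 0.  At a corank 1 point this is typically only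
   a half-plane, bounded by the tangent line; the tangent cone meant here is
   the plane containing it. *)
Definition secant_limits : set 'rV[R]_4 :=
  [set w | exists (q : nat -> 'rV[R]_2) (l : nat -> R),
     [/\ q @ \oo --> (0 : 'rV[R]_2),
         forall k, 0 <= l k &
         (fun k => l k *: (f (q k) - f 0)) @ \oo --> w]].

Definition tangent_cone : set 'rV[R]_4 := lin_span secant_limits.

Definition height (v : 'rV[R]_4) : 'rV[R]_2 -> R := fun q => dot (f q) v.

End SurfaceGerm.

(** ** Singularities and contact *)

Definition hessian (R : realType) (F : 'rV[R]_2 -> R) : 'M[R]_2 :=
  \matrix_(i < 2, j < 2) dpart [:: i; j] F 0.

Definition singularity_A1 (R : realType) (F : 'rV[R]_2 -> R) : Prop :=
  [/\ smooth_germ F,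
      forall i : 'I_2, dpart [:: i] F 0 = 0
    & \det (hessian F) != 0].

(* A1 singularities of the same real type: over R the class A1 splits into
   A1^+ (definite Hessian) and A1^- (saddle).  Up to a nonzero factor, which
   does not change the zero fibre, the sign of the Hessian determinant tells
   them apart. *)
Definition same_A1 (R : realType) (F G : 'rV[R]_2 -> R) : Prop :=
  [/\ singularity_A1 F, singularity_A1 G
    & Num.sg (\det (hessian F)) = Num.sg (\det (hessian G))].

Definition submersion_germ (R : realType) (g : 'rV[R]_4 -> R) : Prop :=
  [/\ smooth_germ g, g 0 = 0
    & forall t : R, exists u, 'd g (0 : 'rV[R]_4) u = t].

Definition model_surface (R : realType) : 'rV[R]_2 -> 'rV[R]_4 :=
  fun q => let x := q 0 0 in let y := q 0 1 in
  vec4 x (x * y) (y ^+ 2) (y ^+ 3).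

(* The contact of the zero fibre of g with the model surface is the singularity
   type at 0 of this composition. *)
Definition contact_map (R : realType) (g : 'rV[R]_4 -> R) : 'rV[R]_2 -> R :=
  g \o @model_surface R.

Definition g3 (R : realType) : 'rV[R]_4 -> R := fun w => w 0 1.

(** ** The parametrisation *)

(* rem is the remainder o(4). *)
Definition corank1_param (R : realType) (b c : nat -> nat -> R) (h : R -> R)
    (rem : 'rV[R]_2 -> 'rV[R]_4) : 'rV[R]_2 -> 'rV[R]_4 :=
  fun q => let x := q 0 0 in let y := q 0 1 in
  vec4 x
       (x * y + h y)
       (\sum_(i < 4) \sum_(j < 4 | (2 <= i + j <= 3)%N)
          b i j * x ^+ i * y ^+ j)
       (c 2%N 0%N * x ^+ 2
        + \sum_(i < 4) \sum_(j < 4 | (i + j == 3)%N) c i j * x ^+ i * y ^+ j)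
  + rem q.

(* Main.v *)
Require Import Defs.
From HB Require Import structures.
From mathcomp Require Import all_boot all_order all_algebra.
From mathcomp Require Import all_classical all_reals all_analysis.
From mathcomp Require Import ring lra zify.

Import Order.TTheory GRing.Theory Num.Theory.
Import numFieldNormedType.Exports.

Local Open Scope classical_set_scope.
Local Open Scope ring_scope.

(* Write f = j + r, where j is the 2-jet of f at 0 and r, which collects h, the
   cubic terms and the remainder, is flat to order 3.  The derivatives of f of
   order at most 2 at 0 are those of j; they give df_0, the second fundamental
   form and the Hessian of h_v, which is v2 times that of xy, as is g_3 composed
   with the model surface.  Since b02 != 0, the norm of the leading part
   (x, 0, b02 y^2, 0) of f is comparable to the weight |x| + y^2, and by Taylor's
   formula the difference of f and its leading part is negligible with respect
   to that weight; so secant limits have no Y and W components. *)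

(** The expansion to first order at q depends only on the germ there, so the differential of F
    serves as that of G, by uniqueness of differentials. *)
Lemma near_eq_differentiable {R : realType} {V W : normedModType R}
    (F G : V -> W) (q : V) :
  {near q, F =1 G} -> differentiable F q -> differentiable G q.
Proof.
move=> FG dF.
have Eq : G \o shift q = cst (G q) + 'd F q +o_ (0 : V) id.
  have /eqaddoP oF := diff_locally dF.
  apply/eqaddoP => e e0; have := oF e e0; move: FG.
  rewrite [\forall x \near q, _](near_shift (0 : V)) subr0 => FG oe.
  near=> y; rewrite -[leLHS]/(`|G (y + q) - (G q + 'd F q y)|).
  have <- : F (y + q) = G (y + q) by near: y; exact: FG.
  have <- : F q = G q by have := nbhs_singleton FG; rewrite /= add0r.
  by near: y; exact: oe.
apply/diff_locallyP; rewrite (diff_unique _ Eq); last exact: diff_continuous.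
by split=> //; exact: diff_continuous.
Unshelve. all: by end_near. Qed.

(** * Smooth germs and their Taylor estimates *)

Section Germs.
Context {R : realType} {n : nat}.
Local Notation E := 'rV[R]_n.+1.

(** On an open set every point has the set as a neighbourhood, so identities that hold throughout it
    may be differentiated again; the inductions on words of indices below rest on this. *)
Lemma smooth_germ_open {V : normedModType R} {F : E -> V} :
  smooth_germ F -> exists2 U : set E, open_nbhs (0 : E) U &
    forall s q, U q -> differentiable (dpart s F) q.
Proof.
case=> U U0 dF; exists U^°; first by split; [exact: open_interior|].
by move=> s q /interior_subset; exact: dF.
Qed.

Lemma dpart_lin {V W : normedModType R} {L : {linear V -> W}} {F : E -> V}
    {U : set E} : continuous L -> open U ->
  (forall s q, U q -> differentiable (dpart s F) q) ->
  forall s q, U q -> dpart s (L \o F) q = L (dpart s F q).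
Proof.
move=> cL oU dF; elim=> [//|i s IH] q Uq /=.
have -> : 'D_(delta_mx 0 i) (dpart s (L \o F)) q =
          'D_(delta_mx 0 i) (L \o dpart s F) q.
  apply: near_eq_derive.
  by near=> y; apply: IH; near: y; exact: open_nbhs_nbhs.
have dL x : differentiable L x by exact: linear_differentiable.
rewrite !deriveE; [|exact: dF|apply: differentiable_comp; [exact: dF|exact: dL]].
by rewrite diff_comp //=; [rewrite diff_lin|exact: dF].
Unshelve. all: by end_near. Qed.

Lemma dpartD {V : normedModType R} {F G : E -> V} {U : set E} : open U ->
  (forall s q, U q -> differentiable (dpart s F) q) ->
  (forall s q, U q -> differentiable (dpart s G) q) ->
  forall s q, U q -> dpart s (F + G) q = dpart s F q + dpart s G q.
Proof.
move=> oU dF dG; elim=> [//|i s IH] q Uq /=.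
rewrite -deriveD; [|exact/diff_derivable/dF|exact/diff_derivable/dG].
apply: near_eq_derive.
by near=> y; apply: IH; near: y; exact: open_nbhs_nbhs.
Unshelve. all: by end_near. Qed.

Lemma smooth_lin {V W : normedModType R} {L : {linear V -> W}} {F : E -> V} :
  continuous L -> smooth_germ F ->
  smooth_germ (L \o F) /\ forall s, dpart s (L \o F) 0 = L (dpart s F 0).
Proof.
move=> cL /smooth_germ_open[U [oU U0] dF].
split=> [|s]; last exact: (dpart_lin cL oU dF).
exists U => [|s q Uq]; first exact: open_nbhs_nbhs.
apply: (@near_eq_differentiable _ _ _ (L \o dpart s F)).
  by near=> y; rewrite (dpart_lin cL oU dF)//; near: y; exact: open_nbhs_nbhs.
by apply: differentiable_comp; [exact: dF|exact: linear_differentiable].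
Unshelve. all: by end_near. Qed.

Lemma smoothD {V : normedModType R} {F G : E -> V} :
  smooth_germ F -> smooth_germ G ->
  smooth_germ (F + G) /\
  forall s, dpart s (F + G) 0 = dpart s F 0 + dpart s G 0.
Proof.
move=> /smooth_germ_open[U1 [oU1 U10] dF] /smooth_germ_open[U2 [oU2 U20] dG].
have oU := openI oU1 oU2; have U0 : (U1 `&` U2) 0 by split.
have {}dF s q : (U1 `&` U2) q -> differentiable (dpart s F) q.
  by case=> ? _; exact: dF.
have {}dG s q : (U1 `&` U2) q -> differentiable (dpart s G) q.
  by case=> _ ?; exact: dG.
split=> [|s]; last exact: (dpartD oU dF dG).
exists (U1 `&` U2) => [|s q Uq]; first exact: open_nbhs_nbhs.
apply: (@near_eq_differentiable _ _ _ (dpart s F + dpart s G)).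
  by near=> y; rewrite (dpartD oU dF dG)//; near: y; exact: open_nbhs_nbhs.
by apply: differentiableD; [exact: dF|exact: dG].
Unshelve. all: by end_near. Qed.

(** Smoothness and vanishing order travel together: this class is stable under sums and under
    composition with continuous linear maps. *)
Definition flat {V : normedModType R} (k : nat) (F : E -> V) :=
  smooth_germ F /\ order_ge k F.

Lemma flatW {V : normedModType R} {k l : nat} {F : E -> V} :
  (k <= l)%N -> flat l F -> flat k F.
Proof. by move=> kl [sF oF]; split=> // s sk; apply: oF; exact: leq_trans kl. Qed.

Lemma flat_lin {V W : normedModType R} {k : nat} {F : E -> V}
    (L : {linear V -> W}) : continuous L -> flat k F -> flat k (L \o F).
Proof.
move=> cL [sF oF]; have [sLF LF] := smooth_lin cL sF.
by split=> // s sk; rewrite LF oF// linear0.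
Qed.

Lemma flatD {V : normedModType R} {k : nat} {F G : E -> V} :
  flat k F -> flat k G -> flat k (F + G).
Proof.
move=> [sF oF] [sG oG]; have [sFG FG] := smoothD sF sG.
by split=> // s sk; rewrite FG oF// oG// addr0.
Qed.

Lemma flat0 {V : normedModType R} {k : nat} : flat k (0 : E -> V).
Proof.
have d0 s : dpart s (0 : E -> V) = 0.
  elim: s => [//|i s /= ->]; apply/funext => q; exact: derive_cst.
split=> [|s _]; last by rewrite d0.
by exists setT => [|s q _]; [exact: filterT|rewrite d0; exact: differentiable_cst].
Qed.

Lemma flat_sum {V : normedModType R} {k : nat} (I : Type) (r : seq I)
    (P : pred I) (F : I -> E -> V) :
  (forall i, P i -> flat k (F i)) -> flat k (\sum_(i <- r | P i) F i).
Proof. by move=> fF; apply: big_ind; [exact: flat0|move=> *; exact: flatD|]. Qed.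

Lemma ler_norm_row (q : E) (i : 'I_n.+1) : `|q 0 i| <= `|q|.
Proof.
rewrite [leRHS]/Num.Def.normr /= mx_normrE.
by apply/bigmax_geP; right => /=; exists (0, i).
Qed.

Lemma derive_coord {V : normedModType R} {F : E -> V} {x : E} (v : E) :
  differentiable F x ->
  'D_v F x = \sum_(i < n.+1) v 0 i *: 'D_(delta_mx 0 i) F x.
Proof.
move=> dF; rewrite deriveE// {1}[v]row_sum_delta linear_sum/=.
by apply: eq_bigr => i _; rewrite linearZ/= deriveE.
Qed.

(* Iterated mean value theorem along the segment from 0 to q. *)
Lemma flat_little_o {k : nat} {F : E -> R} : flat k.+1 F ->
  forall e : R, 0 < e -> \forall q \near (0 : E), `|F q| <= e * `|q| ^+ k.
Proof.
elim: k F => [|k IH] F [sF oF] e e0.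
  have [U [oU U0] dF] := smooth_germ_open sF.
  have F0 : F 0 = 0 by exact: (oF [::]).
  have /cvgrPdist_le/(_ e e0) : F @ (0 : E) --> F 0.
    exact: (differentiable_continuous (dF [::] 0 U0)).
  by rewrite F0; apply: filterS => q; rewrite sub0r normrN expr0 mulr1.
(* The last index of a word is the innermost derivative, so differentiating F first appends an index
   at the end. *)
have dsF s i : dpart s ('D_(delta_mx 0 i) F) = dpart (rcons s i) F.
  by rewrite /dpart foldr_rcons.
have flatDF i : flat k.+1 ('D_(delta_mx 0 i) F).
  split=> [|s sk]; last by rewrite dsF; apply: oF; rewrite size_rcons ltnS.
  case: sF => U U0 dF; exists U => // s q Uq; rewrite dsF; exact: dF.
(* The derivative along q is a sum of n + 1 partial derivatives weighted by coordinates of q; each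
   one gets an equal share of e. *)
have e1 : 0 < e / n.+1%:R by rewrite divr_gt0.
have [U [oU U0] dF] := smooth_germ_open sF.
have : \forall q \near (0 : E), U q /\
    forall i, `|'D_(delta_mx 0 i) F q| <= e / n.+1%:R * `|q| ^+ k.
  near=> q; split; first by near: q; exact: open_nbhs_nbhs.
  by move=> i; move: i; near: q; apply: filter_forall => i; exact: IH.
move=> /nbhs_normP[r /= r0 Br].
have Nr : \forall q \near (0 : E), `|q| < r.
  by apply/nbhs_normP; exists r => // y /=; rewrite sub0r normrN.
near=> q.
have qr : `|q| < r by near: q.
have {}Br (t : R) : 0 <= t <= 1 -> U (t *: q) /\
    forall i, `|'D_(delta_mx 0 i) F (t *: q)| <= e / n.+1%:R * `|q| ^+ k.
  move=> /andP[t0 t1].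
  have tq : `|t *: q| <= `|q| by rewrite normrZ ger0_norm// ler_piMl.
  have [//|Ut DF] := Br (t *: q).
    by rewrite /= sub0r normrN (le_lt_trans tq).
  split=> // i; apply: (le_trans (DF i)).
  by apply: ler_wpM2l; [exact: ltW|apply: lerXn2r; rewrite ?nnegrE].
(* The mean value theorem on [0, 1] gives F q as the derivative of F along q at some c *: q, where
   the induction hypothesis bounds all partial derivatives. *)
pose g (t : R) := F (t *: q).
have dg (t : R) : 0 <= t <= 1 -> is_derive t 1 g ('D_q F (t *: q)).
  move=> t01; have dFt : differentiable F (t *: q).
    by apply: (dF [::]); case: (Br t t01).
  have dZ : differentiable ( *:%R^~ q : R -> E) t by [].
  have dgt : differentiable g t by exact: differentiable_comp.
  apply: DeriveDef; first exact: diff_derivable.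
  by rewrite !deriveE// diff_comp//= diff_val /= scale1r.
have [||c c01] := @MVT_segment R g (fun t => 'D_q F (t *: q)) 0 1 ler01.
- by move=> t; rewrite in_itv/= => /andP[t0 t1]; apply: dg; rewrite !ltW.
- apply: derivable_within_continuous => t; rewrite in_itv/= => t01.
  by have [] := dg t t01.
have F0 : F 0 = 0 by exact: (oF [::]).
rewrite /g scale1r scale0r F0 !subr0 mulr1 => ->.
move: c01; rewrite in_itv/= => c01; have [Uc DFc] := Br c c01.
rewrite derive_coord; last exact: (dF [::]).
rewrite (le_trans (ler_norm_sum _ _ _))//.
apply: (@le_trans _ _ (\sum_(i < n.+1) `|q| * (e / n.+1%:R * `|q| ^+ k))).
  by apply: ler_sum => i _; rewrite normrM ler_pM// ler_norm_row.
rewrite sumr_const card_ord -[leLHS]mulr_natl exprS.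
by rewrite le_eqVlt; apply/orP; left; apply/eqP; field; rewrite addrC natr1.
Unshelve. all: by end_near. Qed.

End Germs.

(** * Coordinates and lines as continuous linear maps *)

Section LinearMaps.
Context {R : realType}.

Definition row_coord {n : nat} (i : 'I_n) (q : 'rV[R]_n) : R := q 0 i.

Fact row_coord_is_linear {n : nat} (i : 'I_n) : linear (row_coord i).
Proof. by move=> a u v; rewrite /row_coord !mxE. Qed.

HB.instance Definition _ n (i : 'I_n) :=
  GRing.isLinear.Build R 'rV[R]_n R _ (row_coord i) (row_coord_is_linear i).

Lemma row_coord_continuous {n : nat} (i : 'I_n) : continuous (row_coord i).
Proof. exact: coord_continuous. Qed.

(** The linear map R -> V sending 1 to e. Composing with it turns a scalar germ into a vector germ
    in the direction e, so that the results on linear maps apply. *)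
Definition line {V : normedModType R} (e : V) (t : R) : V := t *: e.

Fact line_is_linear {V : normedModType R} (e : V) : linear (line e).
Proof. by move=> a u v; rewrite /line scalerDl scalerA. Qed.

HB.instance Definition _ (V : normedModType R) (e : V) :=
  GRing.isLinear.Build R R V _ (line e) (line_is_linear e).

Lemma line_continuous {V : normedModType R} (e : V) : continuous (line e).
Proof. exact: scalel_continuous. Qed.

Lemma derive_lin {V W : normedModType R} (L : {linear V -> W}) (v q : V) :
  continuous L -> 'D_v L q = L v.
Proof. by move=> cL; rewrite deriveE ?diff_lin//; exact: linear_differentiable. Qed.

Lemma derive_row_coord {n : nat} (i : 'I_n.+1) (v q : 'rV[R]_n.+1) :
  'D_v (row_coord i) q = v 0 i.
Proof. exact/derive_lin/row_coord_continuous. Qed.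

(** The innermost derivative of L is constant and any further one is zero, hence the induction from
    the end of the word. *)
Lemma smooth_linear {n : nat} {W : normedModType R} (L : {linear 'rV[R]_n.+1 -> W}) :
  continuous L -> smooth_germ L.
Proof.
move=> cL; exists setT => [|s q _]; first exact: filterT.
elim/last_ind: s => [|s i _]; first exact: linear_differentiable.
have -> : dpart (rcons s i) L =
    cst (if s is [::] then L (delta_mx 0 i) else 0).
  rewrite /dpart foldr_rcons /=.
  have -> : 'D_(delta_mx 0 i) L = cst (L (delta_mx 0 i)).
    by apply/funext => y; exact: derive_lin.
  elim: s => [//|j s /= ->]; apply/funext => y; exact: derive_cst.
exact: differentiable_cst.
Qed.

Lemma ler_row_norm {n : nat} (u : 'rV[R]_n) (e : R) : 0 <= e ->
  (forall i, `|u 0 i| <= e) -> `|u| <= e.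
Proof.
move=> e0 ue; rewrite [leLHS]/Num.Def.normr /= mx_normrE.
by apply: bigmax_le => // -[i j] _ /=; rewrite (ord1 i).
Qed.

Lemma flat_little_o_row {n m k : nat} {F : 'rV[R]_n.+1 -> 'rV[R]_m.+1} :
  flat k.+1 F ->
  forall e : R, 0 < e -> \forall q \near (0 : 'rV[R]_n.+1), `|F q| <= e * `|q| ^+ k.
Proof.
move=> fF e e0; near=> q; apply: ler_row_norm.
  by rewrite mulr_ge0 ?exprn_ge0// ltW.
move=> i; move: i; near: q; apply: filter_forall => i.
exact: (flat_little_o (flat_lin (row_coord i) (row_coord_continuous i) fF)).
Unshelve. all: by end_near. Qed.

End LinearMaps.

(** * Monomials in the plane *)

Section PlaneGerms.
Context {R : realType}.

Definition mono (a b : nat) (q : 'rV[R]_2) : R := q 0 0 ^+ a * q 0 1 ^+ b.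

(** The scalar c makes the formula iterable. The truncated predecessor does no harm: at exponent 0
    the coefficient vanishes. *)
Lemma derive_mono (c : R) (a b : nat) (k : 'I_2) :
  'D_(delta_mx 0 k) (c *: mono a b) =
  (c * (if k == 0 then a else b)%:R) *:
    mono (if k == 0 then a.-1 else a) (if k == 0 then b else b.-1).
Proof.
apply/funext => q.
have dC i : derivable (row_coord i) q (delta_mx 0 k : 'rV[R]_2).
  apply/diff_derivable/linear_differentiable/row_coord_continuous.
have -> : mono a b = row_coord 0 ^+ a * row_coord 1 ^+ b.
  by apply/funext => y; rewrite /mono !fctE.
rewrite deriveZ; last by apply: derivableM; exact: derivableX.
rewrite deriveM; [|exact: derivableX..].
rewrite !deriveX// !derive_row_coord.
rewrite /row_coord !mxE /= !fctE /mono.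
by case: k {dC} => [[|[|k]] //= kk]; rewrite /GRing.scale /=; ring.
Qed.

Lemma derive_mono1 (a b : nat) (k : 'I_2) :
  'D_(delta_mx 0 k) (mono a b) =
  (if k == 0 then a else b)%:R *:
    mono (if k == 0 then a.-1 else a) (if k == 0 then b else b.-1).
Proof. by have := derive_mono 1 a b k; rewrite scale1r mul1r. Qed.

(** Each derivative lowers the total degree by at most one, so fewer than a + b of them leave a
    multiple of a monomial of positive degree, which vanishes at 0. *)
Lemma flat_mono (a b : nat) : flat (a + b) (mono a b).
Proof.
(* Only an inequality between degrees holds: at exponent 0 the truncated predecessor does not lower
   the degree. *)
have key s : exists c a' b', dpart s (mono a b) = c *: mono a' b' /\
    (a + b <= size s + (a' + b'))%N.
  elim: s => [|k s [c [a' [b' [/= -> ab]]]]].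
    by exists 1, a, b; split=> //; apply/funext => q; rewrite !fctE scale1r.
  rewrite derive_mono; set d := c * _.
  case: ifP => _.
    by exists d, a'.-1, b'; split=> //; apply: (leq_trans ab); lia.
  by exists d, a', b'.-1; split=> //; apply: (leq_trans ab); lia.
have dC i q : differentiable (row_coord i : 'rV[R]_2 -> R) q.
  exact/linear_differentiable/row_coord_continuous.
split.
  exists setT => [|s q _]; first exact: filterT.
  have [c [a' [b' [-> _]]]] := key s.
  apply: differentiableZ.
  have -> : mono a' b' = row_coord 0 ^+ a' * row_coord 1 ^+ b'.
    by apply/funext => y; rewrite /mono !fctE.
  apply: differentiableM.
    by case: a' => [|a']; [exact: differentiable_cst|exact: differentiableX].
  by case: b' => [|b']; [exact: differentiable_cst|exact: differentiableX].
move=> s sab; have [c [a' [b' [-> ab]]]] := key s.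
rewrite !fctE /mono !mxE.
case: a' ab => [|a'] ab; last by rewrite exprS !mul0r scaler0.
case: b' ab => [|b'] ab; last by rewrite exprS mul0r mulr0 scaler0.
by move: ab sab; rewrite !addn0; lia.
Qed.

Lemma mono0 (a b : nat) : mono a b 0 = ((a == 0%N) && (b == 0%N))%:R.
Proof. by rewrite /mono !mxE !expr0n -natrM mulnb. Qed.

Lemma dpart1_mono (a b : nat) (i : 'I_2) :
  dpart [:: i] (mono a b) 0 =
  (if i == 0 then (a == 1%N) && (b == 0%N) else (a == 0%N) && (b == 1%N))%:R.
Proof.
rewrite [LHS](congr1 (@^~ 0) (derive_mono1 a b i)) !fctE mono0 -[LHS]natrM.
by case: ifP => _; case: a => [|[|a]]; case: b => [|[|b]]; rewrite /= ?muln0.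
Qed.

Lemma dpart2_mono (a b : nat) (i j : 'I_2) :
  dpart [:: i; j] (mono a b) 0 =
  (if (i == 0) && (j == 0) then (a == 2%N) && (b == 0%N) else
   if (i == 0) || (j == 0) then (a == 1%N) && (b == 1%N) else
   (a == 0%N) && (b == 2%N))%:R *+ (if i == j then 2 else 1).
Proof.
rewrite /= derive_mono1.
rewrite [LHS](congr1 (@^~ 0) (derive_mono _ _ _ i)) !fctE mono0.
rewrite -natrM -[LHS]natrM -[RHS]mulr_natr -[RHS]natrM; congr (_%:R).
by case: i => [[|[|i]] //= ii]; case: j => [[|[|j]] //= jj];
  case: a => [|[|[|a]]]; case: b => [|[|[|b]]]; rewrite /= ?muln0.
Qed.

Lemma derive_comp_coord0 {V : normedModType R} (g : R -> V) :
  'D_(delta_mx 0 0) (g \o row_coord 1) = (0 : 'rV[R]_2 -> V).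
Proof.
apply/funext => q; rewrite /derive.
under eq_fun do rewrite /row_coord /= !mxE /= mulr0 add0r subrr scaler0.
exact: lim_cst.
Qed.

Lemma derive_comp_coord1 {V : normedModType R} (g : R -> V) :
  'D_(delta_mx 0 1) (g \o row_coord 1) = derive1 g \o (row_coord 1 : 'rV[R]_2 -> R).
Proof.
apply/funext => q; rewrite /derive /derive1 /=.
by under eq_fun do rewrite /row_coord /= !mxE /= mulr1.
Qed.

(* No derivability of h is needed: the difference quotients coincide, hence so
   do their limits, junk values included. *)
Lemma dpart_comp_coord (h : R -> R) (s : seq 'I_2) :
  dpart s (h \o row_coord 1) =
  if all (pred1 1) s then derive1n (size s) h \o row_coord 1 else 0.
Proof.
elim: s => [//|i s /= ->].
have [->|i1] := eqVneq i 1.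
  rewrite /=; case: ifP => _; first by rewrite derive_comp_coord1.
  by apply/funext => q; exact: derive_cst.
have -> : i = 0 by case: i i1 => [[|[|i]]//= ii] _; exact/val_inj.
by case: ifP => _; [exact: derive_comp_coord0|apply/funext => q; exact: derive_cst].
Qed.

Lemma flat_comp_coord {k : nat} {h : R -> R} :
  smooth_germ1 h -> order_ge1 k h -> flat k (h \o row_coord 1 : 'rV[R]_2 -> R).
Proof.
move=> [U U0 dh] oh; split=> [|s sk]; last first.
  by rewrite dpart_comp_coord; case: ifP => _ //=; rewrite /row_coord mxE oh.
exists (row_coord 1 @^-1` U) => [|s q Uq].
  by apply: row_coord_continuous; rewrite /row_coord mxE.
rewrite dpart_comp_coord; case: ifP => _; last exact: differentiable_cst.
apply: differentiable_comp.
  exact/linear_differentiable/row_coord_continuous.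
exact/derivable1_diffP/dh.
Qed.

End PlaneGerms.

(** * Coordinates, spans and orthogonal projection in R^4 *)

Section Coordinates.
Context {R : realType}.

Lemma row4P (u w : 'rV[R]_4) :
  u 0 0 = w 0 0 -> u 0 1 = w 0 1 -> u 0 2 = w 0 2 -> u 0 3 = w 0 3 -> u = w.
Proof.
move=> u0 u1 u2 u3; apply/rowP => -[[|[|[|[|i]]]] //= ii].
- by move: u0; congr (u _ _ = w _ _); apply/val_inj.
- by move: u1; congr (u _ _ = w _ _); apply/val_inj.
- by move: u2; congr (u _ _ = w _ _); apply/val_inj.
- by move: u3; congr (u _ _ = w _ _); apply/val_inj.
Qed.

Lemma vec4E (a b c d : R) :
  (vec4 a b c d 0 0 = a) * (vec4 a b c d 0 1 = b) *
  (vec4 a b c d 0 2 = c) * (vec4 a b c d 0 3 = d).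
Proof. by rewrite /vec4 !mxE. Qed.

Lemma dot4 (u w : 'rV[R]_4) : dot u w =
  u 0 0 * w 0 0 + u 0 1 * w 0 1 + u 0 2 * w 0 2 + u 0 3 * w 0 3.
Proof.
rewrite /dot !big_ord_recl big_ord0 addr0 !addrA.
by do !congr (_ + _); congr (u _ _ * w _ _); apply/val_inj.
Qed.

Lemma det_mx22 (A : 'M[R]_2) : \det A = A 0 0 * A 1 1 - A 0 1 * A 1 0.
Proof.
rewrite (expand_det_row A 0) !big_ord_recl big_ord0 /cofactor !det_mx11 !mxE /=.
rewrite (_ : lift 0 0 = 1 :> 'I_2); last exact/val_inj.
rewrite (_ : lift 1 0 = 0 :> 'I_2); last exact/val_inj.
by rewrite /bump /= expr0 expr1; ring.
Qed.

(** Applied to coordinate functions, this confines the span of secant limits, or of differences of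
    points of the curvature parabola, to a coordinate plane. *)
Lemma lin_span_ker {V : normedModType R} (A : set V) (L : {linear V -> R}) :
  (forall w, A w -> L w = 0) -> forall w, lin_span A w -> L w = 0.
Proof.
move=> LA w [k [a [x [Ax ->]]]]; rewrite linear_sum big1// => i _.
by rewrite linearZ/= LA ?scaler0.
Qed.

Lemma lin_span2 {V : normedModType R} (A : set V) (s t : R) (u w : V) :
  A u -> A w -> lin_span A (s *: u + t *: w).
Proof.
move=> Au Aw; exists 2%N, (fun i => if i == 0 then s else t),
  (fun i => if i == 0 then u else w); split=> [i|]; first by case: ifP.
by rewrite !big_ord_recl big_ord0 addr0.
Qed.

Lemma XZ_planeP (w : 'rV[R]_4) : XZ_plane w <-> w 0 1 = 0 /\ w 0 3 = 0.
Proof.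
split=> [[a [b ->]]|[w1 w3]]; first by rewrite !vec4E.
by exists (w 0 0), (w 0 2); apply: row4P; rewrite !vec4E.
Qed.

Lemma YZ_planeP (w : 'rV[R]_4) : YZ_plane w <-> w 0 0 = 0 /\ w 0 3 = 0.
Proof.
split=> [[a [b ->]]|[w1 w3]]; first by rewrite !vec4E.
by exists (w 0 1), (w 0 2); apply: row4P; rewrite !vec4E.
Qed.

(** Since [xget] returns an arbitrary element of its set, both existence and uniqueness of the
    projection are needed. *)
Lemma orth_proj_normal (w : 'rV[R]_4) :
  orth_proj [set m : 'rV[R]_4 | m 0 0 = 0] w = vec4 0 (w 0 1) (w 0 2) (w 0 3).
Proof.
rewrite /orth_proj; set S := [set m | _].
have : S (vec4 0 (w 0 1) (w 0 2) (w 0 3)).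
  split=> /=; first by rewrite vec4E.
  by move=> t /= t0; rewrite dot4 !mxE t0 /=; ring.
move=> /(xgetI 0); set m := xget 0 S => -[/= m0 wm].
(* Uniqueness: the basis vectors other than the first lie in the normal space, and w - m is
   orthogonal to each of them. *)
have wmi (i : 'I_4) : i != 0 -> w 0 i = m 0 i.
  move=> i0; apply/eqP; rewrite -subr_eq0; apply/eqP.
  have := wm (delta_mx 0 i); rewrite /= mxE eq_sym (negbTE i0) andbF.
  move=> /(_ erefl); rewrite /dot (bigD1 i)//= !mxE !eqxx mulr1 big1 ?addr0//.
  by move=> j ji; rewrite !mxE (negbTE ji) andbF mulr0.
by apply: row4P; rewrite !vec4E ?m0// wmi.
Qed.

End Coordinates.

(** * The corank 1 surface *)

Section Corank1.
Context {R : realType} (b c : nat -> nat -> R) (h : R -> R)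
  (rem : 'rV[R]_2 -> 'rV[R]_4).
Context (hb : b 0%N 2%N != 0) (h_smooth : smooth_germ1 h)
  (h_order : order_ge1 4 h) (rem_smooth : smooth_germ rem)
  (rem_order : order_ge 4 rem).
Local Notation f := (corank1_param b c h rem).

(** * Splitting the parametrisation into its 2-jet and a flat part *)

Definition mono_vec (i j : nat) (e : 'rV[R]_4) : 'rV[R]_2 -> 'rV[R]_4 :=
  line e \o mono i j.

(** The first two summands form the leading part (x, 0, b02 y^2, 0); the other two collect the terms
    in xy and x^2. *)
Definition two_jet : 'rV[R]_2 -> 'rV[R]_4 :=
  mono_vec 1 0 (vec4 1 0 0 0) + mono_vec 0 2 (vec4 0 0 (b 0 2) 0)
  + (mono_vec 1 1 (vec4 0 1 (b 1 1) 0)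
     + mono_vec 2 0 (vec4 0 0 (b 2 0) (c 2 0))).

Definition higher_order : 'rV[R]_2 -> 'rV[R]_4 :=
  line (vec4 0 1 0 0) \o (h \o row_coord 1)
  + \sum_(i < 4) \sum_(j < 4 | (i + j == 3)%N)
      mono_vec i j (vec4 0 0 (b i j) (c i j))
  + rem.

Lemma corank1_decomp : f = two_jet + higher_order.
Proof.
apply/funext => q; rewrite /corank1_param /two_jet /higher_order !fctE !addrA.
congr (_ + _); rewrite /mono_vec /line /mono /row_coord /=.
rewrite !big_mkcond /=; under [X in vec4 _ _ X _]eq_bigr do rewrite big_mkcond /=.
under [X in vec4 _ _ _ (_ + X)]eq_bigr do rewrite big_mkcond /=.
rewrite fct_sumE.
under [X in _ = _ + X]eq_bigr do rewrite fct_sumE big_mkcond /=.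
rewrite !(big_ord_recl, big_ord0) /= /bump /=.
by apply: row4P; rewrite !mxE /=; ring.
Qed.

Lemma flat_mono_vec (i j : nat) (e : 'rV[R]_4) : flat (i + j) (mono_vec i j e).
Proof. exact/(flat_lin (line e) (line_continuous e))/flat_mono. Qed.

(** The germ h and the remainder have order at least 4, and the cubic monomials order 3. *)
Lemma flat_higher_order : flat 3 higher_order.
Proof.
apply: flatD; last exact: (@flatW _ _ _ 3 4).
apply: flatD.
  apply: (flat_lin (line _) (line_continuous _)).
  exact/(@flatW _ _ _ 3 4)/flat_comp_coord.
apply: flat_sum => i _; apply: flat_sum => j /eqP ij.
by have := flat_mono_vec i j (vec4 0 0 (b i j) (c i j)); rewrite ij.
Qed.

Lemma smooth_mono_vec (i j : nat) (e : 'rV[R]_4) :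
  smooth_germ (mono_vec i j e) /\
  forall s, dpart s (mono_vec i j e) 0 = dpart s (mono i j) 0 *: e.
Proof. exact: (smooth_lin (line_continuous e) (proj1 (flat_mono i j))). Qed.

Lemma smooth_corank1 : smooth_germ f /\
  forall s, (size s < 3)%N -> dpart s f 0 =
    dpart s (mono 1 0) 0 *: vec4 1 0 0 0
    + dpart s (mono 0 2) 0 *: vec4 0 0 (b 0 2) 0
    + (dpart s (mono 1 1) 0 *: vec4 0 1 (b 1 1) 0
       + dpart s (mono 2 0) 0 *: vec4 0 0 (b 2 0) (c 2 0)).
Proof.
rewrite corank1_decomp; have [sr or] := flat_higher_order.
have [s1 d1] := smooth_mono_vec 1 0 (vec4 1 0 0 0).
have [s2 d2] := smooth_mono_vec 0 2 (vec4 0 0 (b 0 2) 0).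
have [s3 d3] := smooth_mono_vec 1 1 (vec4 0 1 (b 1 1) 0).
have [s4 d4] := smooth_mono_vec 2 0 (vec4 0 0 (b 2 0) (c 2 0)).
have [s12 d12] := smoothD s1 s2; have [s34 d34] := smoothD s3 s4.
have [sj dj] := smoothD s12 s34; have [sf df] := smoothD sj sr.
split=> // s s3'; rewrite df dj d12 d34 d1 d2 d3 d4.
by rewrite or// addr0.
Qed.

Lemma dpart1_corank1 (i : 'I_2) :
  dpart [:: i] f 0 = (i == 0)%:R *: vec4 1 0 0 0.
Proof.
rewrite (proj2 smooth_corank1)// !dpart1_mono.
by case: (i == 0); rewrite /= ?scale0r ?addr0.
Qed.

Lemma dpart2_corank1 (i j : 'I_2) : dpart [:: i; j] f 0 =
  vec4 0 (i != j)%:R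
    (if i == j then 2 * (if i == 0 then b 2 0 else b 0 2) else b 1 1)
    (if (i == 0) && (j == 0) then 2 * c 2 0 else 0).
Proof.
rewrite (proj2 smooth_corank1)// !dpart2_mono.
case: i => [[|[|i]] //= ii]; case: j => [[|[|j]] //= jj];
  by apply: row4P; rewrite !mxE /=; ring.
Qed.

Lemma corank1_0 : f 0 = 0.
Proof.
rewrite -[f 0]/(dpart [::] f 0) (proj2 smooth_corank1)// /= /mono !mxE.
by rewrite !(expr0, expr1, expr0n, mul0r, mulr0, scale0r, addr0).
Qed.

(** * Differential, second fundamental form and the plane E_p *)

Lemma diff_corank1 (u : 'rV[R]_2) : 'd f 0 u = u 0 0 *: vec4 1 0 0 0.
Proof.
have [[U U0 dF] _] := smooth_corank1.
have df0 : differentiable f 0 by apply: (dF [::]); exact: nbhs_singleton.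
rewrite -deriveE// derive_coord//.
under eq_bigr => i _ do rewrite -[X in _ *: X]/(dpart [:: i] f 0) dpart1_corank1.
by rewrite !big_ord_recl big_ord0 /= scale1r scale0r scaler0 !addr0.
Qed.

Lemma normal_space_corank1 :
  Defs.normal_space f = [set m : 'rV[R]_4 | m 0 0 = 0].
Proof.
apply/seteqP; split=> w /=.
  move=> /(_ (vec4 1 0 0 0)); rewrite dot4 !vec4E !mulr0 mulr1 !addr0; apply.
  by exists (delta_mx 0 0) => //; rewrite diff_corank1 mxE !eqxx scale1r.
by move=> w0 t [u _ <-]; rewrite diff_corank1 dot4 w0 !mxE /=; ring.
Qed.

Lemma second_form_corank1 (u : 'rV[R]_2) : second_form f u u =
  let x := u 0 0 in let y := u 0 1 in
  vec4 0 (2 * x * y) (2 * b 2 0 * x ^+ 2 + 2 * b 1 1 * (x * y) + 2 * b 0 2 * y ^+ 2)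
    (2 * c 2 0 * x ^+ 2).
Proof.
rewrite /second_form normal_space_corank1 orth_proj_normal.
under eq_bigr => i _ do under eq_bigr => j _ do rewrite dpart2_corank1.
rewrite !big_ord_recl !big_ord0.
rewrite (_ : lift ord0 ord0 = 1 :> 'I_2); last exact/val_inj.
by apply: row4P; rewrite !mxE /=; ring.
Qed.

(** As df_0 sends (x, y) to (x, 0, 0, 0), the unit condition reads x^2 = 1 and leaves y free. *)
Lemma curvature_parabola_corank1 (x y : R) : x ^+ 2 = 1 ->
  curvature_parabola f
    (vec4 0 (2 * x * y) (2 * b 2 0 + 2 * b 1 1 * (x * y) + 2 * b 0 2 * y ^+ 2)
       (2 * c 2 0)).
Proof.
move=> x1; exists (\row_(i < 2) [:: x; y]`_i); last first.
  by rewrite second_form_corank1 !mxE /= x1 !mulr1.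
rewrite /= diff_corank1 mxE /= /enorm dot4 !mxE /=.
by rewrite mulr1 !mulr0 !addr0 -expr2 x1 sqrtr1.
Qed.

(** The W coordinate is constant along the parabola, so differences of its points have none. *)
Lemma curvature_parabolaP (w : 'rV[R]_4) : curvature_parabola f w ->
  w 0 0 = 0 /\ w 0 3 = 2 * c 2 0.
Proof.
move=> [u /= u1 <-]; rewrite second_form_corank1 !vec4E; split=> //.
move: u1; rewrite diff_corank1 /enorm dot4 !mxE /= mulr1 !mulr0 !addr0 -expr2.
by rewrite sqrtr_sqr => u1; rewrite -(real_normK (num_real (u 0 0))) u1 expr1n mulr1.
Qed.

Lemma E_plane_corank1 : E_plane f = @YZ_plane R.
Proof.
apply/seteqP; split=> w.
  move=> Ew; apply/YZ_planeP; split.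
    apply: (lin_span_ker _ (row_coord 0) _ _ Ew) => _ [p [q [Pp Pq ->]]].
    have [p0 _] := curvature_parabolaP _ Pp; have [q0 _] := curvature_parabolaP _ Pq.
    by rewrite linearB /= /row_coord p0 q0 subrr.
  apply: (lin_span_ker _ (row_coord 3) _ _ Ew) => _ [p [q [Pp Pq ->]]].
  have [_ p3] := curvature_parabolaP _ Pp; have [_ q3] := curvature_parabolaP _ Pq.
  by rewrite linearB /= /row_coord p3 q3 subrr.
move=> [y [z ->]].
(* The parabola parametrised by the unit vectors with x = 1 and y = t. *)
pose p t := vec4 0 (2 * 1 * t)
  (2 * b 2 0 + 2 * b 1 1 * (1 * t) + 2 * b 0 2 * t ^+ 2) (2 * c 2 0).
have P t : curvature_parabola f (p t).
  by apply: curvature_parabola_corank1; rewrite expr1n.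
have D s t : exists a d, [/\ curvature_parabola f a, curvature_parabola f d &
    p s - p t = a - d] by exists (p s), (p t).
(* The differences are (0, 4, 4 b11, 0) and (0, 2, 2 b11 + 2 b02, 0), independent because b02 != 0;
   k solves the equation for the Z coordinate. *)
pose k := (z - y * b 1 1) / (4 * b 0 2).
have -> : vec4 0 y z 0 =
    (y / 4 - k) *: (p 1 - p (-1)) + (2 * k) *: (p 1 - p 0).
  by apply: row4P; rewrite !mxE /= /k; field.
exact: lin_span2 (D _ _) (D _ _).
Qed.

(** * Weighted estimates and the tangent cone *)

Definition leading (q : 'rV[R]_2) : 'rV[R]_4 :=
  vec4 (q 0 0) 0 (b 0 2 * q 0 1 ^+ 2) 0.

(** With x of weight 2 and y of weight 1, [leading] is the quasi-homogeneous part of degree 2 of f,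
    and this is a gauge of the same degree. *)
Definition weight (q : 'rV[R]_2) : R := `|q 0 0| + q 0 1 ^+ 2.

Lemma weight_ge0 (q : 'rV[R]_2) : 0 <= weight q.
Proof. by rewrite addr_ge0// sqr_ge0. Qed.

(** For [|x| <= 1] one has [x^2 <= |x|]. Thus a bound o(|q|^2), as given by flatness of order 3, is
    also o(weight). *)
Lemma norm_sqr_weight (q : 'rV[R]_2) : `|q| <= 1 -> `|q| ^+ 2 <= weight q.
Proof.
move=> q1; have x1 : `|q 0 0| <= 1 by rewrite (le_trans (ler_norm_row q 0)).
have qm : `|q| <= Num.max `|q 0 0| `|q 0 1|.
  apply: ler_row_norm => [|[[|[|i]] //= ii]]; first by rewrite le_max normr_ge0.
    by rewrite (_ : Ordinal ii = 0) ?le_max ?lexx//; exact/val_inj.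
  by rewrite (_ : Ordinal ii = 1) ?le_max ?lexx ?orbT//; exact/val_inj.
have : `|q| ^+ 2 <= Num.max `|q 0 0| `|q 0 1| ^+ 2.
  by apply: lerXn2r qm; rewrite nnegrE ?le_max normr_ge0.
move=> /le_trans; apply; case: (leP `|q 0 0| `|q 0 1|) => _.
  by rewrite real_normK ?num_real// lerDr.
by rewrite (@le_trans _ _ `|q 0 0|)// ?lerDl ?sqr_ge0// expr2 ler_piMl.
Qed.

Lemma corank1_leading (e : R) : 0 < e ->
  \forall q \near (0 : 'rV[R]_2), `|f q - leading q| <= e * weight q.
Proof.
move=> e0.
pose u := vec4 0 1 (b 1 1) 0; pose w := vec4 0 0 (b 2 0) (c 2 0).
(* The terms xy u, x^2 w and [higher_order] are bounded by the weight times d |u|, d |w| and d, and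
   these three factors add up to e. *)
pose d := e / (`|u| + `|w| + 1).
have s0 : 0 < `|u| + `|w| + 1 by rewrite ltr_wpDl// addr_ge0.
have d0 : 0 < d by rewrite divr_gt0.
have Nd : \forall q \near (0 : 'rV[R]_2), `|q| < Num.min 1 d.
  apply/nbhs_normP; exists (Num.min 1 d); first by rewrite /= lt_min ltr01.
  by move=> q /=; rewrite sub0r normrN.
near=> q.
have /andP[q1 qd] : (`|q| < 1) && (`|q| < d).
  by rewrite -lt_min; near: q.
have -> : f q - leading q =
    (q 0 0 * q 0 1) *: u + q 0 0 ^+ 2 *: w + higher_order q.
  rewrite corank1_decomp /two_jet /mono_vec /mono /line !fctE /= /leading.
  by apply: row4P; rewrite !mxE /=; ring.
have x0 : `|q 0 0| <= d by rewrite (le_trans (ler_norm_row q 0))// ltW.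
have y0 : `|q 0 1| <= d by rewrite (le_trans (ler_norm_row q 1))// ltW.
have xw : `|q 0 0| <= weight q by rewrite lerDl sqr_ge0.
have hq : `|higher_order q| <= d * weight q.
  rewrite (@le_trans _ _ (d * `|q| ^+ 2))//.
    by near: q; exact: flat_little_o_row flat_higher_order _ d0.
  by rewrite ler_wpM2l ?norm_sqr_weight// ltW.
have -> : e = d * `|u| + d * `|w| + d.
  by rewrite /d; field; rewrite gt_eqF.
rewrite !mulrDl (le_trans (ler_normD _ _))// lerD//.
rewrite (le_trans (ler_normD _ _))// lerD// normrZ -mulrAC ler_wpM2r//.
  by rewrite normrM mulrC ler_pM.
by rewrite normrX expr2 ler_pM.
Unshelve. all: by end_near. Qed.

(** The leading part has no Y and W components, so those of f are components of f - leading, which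
    is small against the weight and hence against |f|. *)
Lemma corank1_negligible (e : R) : 0 < e ->
  \forall q \near (0 : 'rV[R]_2),
    `|f q 0 1| <= e * `|f q| /\ `|f q 0 3| <= e * `|f q|.
Proof.
(* The X coordinate of [leading] bounds |x|, and its Z coordinate bounds y^2 up to the factor
   |b02|^-1. *)
move=> e0; pose C := 1 + `|b 0 2|^-1.
have C0 : 0 < C by rewrite ltr_pwDl// invr_ge0.
have wC q : weight q <= C * `|leading q|.
  rewrite mulrDl mul1r lerD//.
    by have := ler_norm_row (leading q) 0; rewrite vec4E.
  rewrite ler_pdivlMl ?normr_gt0//.
  have := ler_norm_row (leading q) 2; rewrite vec4E normrM.
  by rewrite (ger0_norm (sqr_ge0 _)).
(* The first bound lets half of the weight be absorbed on the left, giving weight <= 2 C |f|; the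
   second turns this into the factor e. *)
pose d := Num.min (2 * C)^-1 (e / (2 * C)).
have d0 : 0 < d by rewrite lt_min invr_gt0 divr_gt0 ?mulr_gt0.
near=> q.
have fl : `|f q - leading q| <= d * weight q.
  by near: q; exact: corank1_leading.
have dC : d * weight q <= (2 * C)^-1 * weight q.
  by rewrite ler_wpM2r ?weight_ge0// ge_min lexx.
have de : d * weight q <= e / (2 * C) * weight q.
  by rewrite ler_wpM2r ?weight_ge0// ge_min lexx orbT.
have lf : `|leading q| <= `|f q| + d * weight q.
  rewrite -(subrK (f q) (leading q)) addrC (le_trans (ler_normD _ _))//.
  by rewrite lerD2l distrC.
have wf : weight q <= 2 * C * `|f q|.
  have : weight q <= C * (`|f q| + (2 * C)^-1 * weight q).
    by rewrite (le_trans (wC q))// ler_wpM2l ?(ltW C0)// (le_trans lf)// lerD2l.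
  have -> : C * (`|f q| + (2 * C)^-1 * weight q) = C * `|f q| + weight q / 2.
    by field; rewrite gt_eqF.
  lra.
have key : `|f q - leading q| <= e * `|f q|.
  rewrite (le_trans fl)// (le_trans de)// -mulrA.
  by apply: ler_wpM2l; [exact: ltW|rewrite ler_pdivrMl ?mulr_gt0].
split; apply: le_trans key.
  by have := ler_norm_row (f q - leading q) 1; rewrite !mxE /= subr0.
by have := ler_norm_row (f q - leading q) 3; rewrite !mxE /= subr0.
Unshelve. all: by end_near. Qed.

Lemma secant_limits_XZ (w : 'rV[R]_4) : secant_limits f w -> XZ_plane w.
Proof.
move=> [q [l [q0 l0 lw]]].
have lw' : (fun k => `|l k *: f (q k)|) @ \oo --> `|w|.
  have -> : (fun k => `|l k *: f (q k)|) = (fun k => `|l k *: (f (q k) - f 0)|).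
    by apply/funext => k; rewrite corank1_0 subr0.
  exact: cvg_norm.
have small (i : 'I_4) : (forall e : R, 0 < e ->
    \forall p \near (0 : 'rV[R]_2), `|f p 0 i| <= e * `|f p|) -> w 0 i = 0.
  move=> fi; apply/eqP; apply: contraT => wi.
  have lwi : (fun k => `|l k * f (q k) 0 i|) @ \oo --> `|w 0 i|.
    have -> : (fun k => `|l k * f (q k) 0 i|) =
        (fun k => `|row_coord i (l k *: (f (q k) - f 0))|).
      by apply/funext => k; rewrite linearZ /= corank1_0 subr0.
    apply: cvg_norm; exact: (cvg_comp _ _ lw (row_coord_continuous i w)).
  have W : 0 < `|w| by rewrite (lt_le_trans _ (ler_norm_row w i))// normr_gt0.
  (* With this e, passing to the limit in the estimate along the secants gives |w_i| <= |w_i| / 2,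
     which contradicts w_i != 0. *)
  have /(fi _) Ne : 0 < `|w 0 i| / (2 * `|w|).
    by rewrite divr_gt0 ?normr_gt0// mulr_gt0.
  have : `|w 0 i| <= `|w 0 i| / (2 * `|w|) * `|w|.
    have lwe : (fun k => `|w 0 i| / (2 * `|w|) * `|l k *: f (q k)|) @ \oo -->
        `|w 0 i| / (2 * `|w|) * `|w| by exact: cvgMl_tmp.
    apply: (ler_cvg_to lwi lwe).
    near=> k; rewrite normrM normrZ mulrCA ler_wpM2l//.
    by near: k; exact: q0 Ne.
  have -> : `|w 0 i| / (2 * `|w|) * `|w| = `|w 0 i| / 2.
    by field; rewrite gt_eqF.
  have : 0 < `|w 0 i| by rewrite normr_gt0.
  lra.
apply/XZ_planeP; split; apply: small => e e0;
  by apply: filterS (corank1_negligible e e0) => p [].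
Unshelve. all: by end_near. Qed.

(** Scaling by the inverse of the weight makes the error l (f - leading) tend to 0, so the scaled
    secants have the limit of the scaled leading parts. *)
Lemma secant_limits_leading (q : nat -> 'rV[R]_2) (l : nat -> R) (w : 'rV[R]_4) :
  q @ \oo --> (0 : 'rV[R]_2) -> (forall k, 0 <= l k) ->
  (forall k, l k * weight (q k) = 1) -> (forall k, l k *: leading (q k) = w) ->
  secant_limits f w.
Proof.
move=> q0 l0 lq lw; exists q, l; split=> //.
apply/cvgrPdist_le => e e0; near=> k.
rewrite -(lw k) corank1_0 subr0 distrC -scalerBr normrZ ger0_norm//.
rewrite -[leRHS]mulr1 -(lq k) mulrCA ler_wpM2l//.
by near: k; exact: q0 (corank1_leading e e0).
Unshelve. all: by end_near. Qed.

Lemma cvg_harmonic_line (v : 'rV[R]_2) :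
  (fun k => k.+1%:R^-1 *: v) @ \oo --> (0 : 'rV[R]_2).
Proof. by rewrite -(scale0r v); apply: cvgZr_tmp; exact: cvg_harmonic. Qed.

Lemma tangent_cone_corank1 : tangent_cone f = @XZ_plane R.
Proof.
apply/seteqP; split=> w.
  move=> Tw; apply/XZ_planeP; split.
    apply: (lin_span_ker _ (row_coord 1) _ _ Tw) => u /secant_limits_XZ.
    by move=> /XZ_planeP[].
  apply: (lin_span_ker _ (row_coord 3) _ _ Tw) => u /secant_limits_XZ.
  by move=> /XZ_planeP[].
move=> [x [z ->]].
have k0 k : k.+1%:R != 0 :> R by rewrite pnatr_eq0.
(* Approach along the x-axis, where the weight is 1/(k+1). *)
have SX : secant_limits f (vec4 1 0 0 0).
  apply: (secant_limits_leading _ (fun k => k.+1%:R) _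
    (cvg_harmonic_line (delta_mx 0 0))) => // k.
    rewrite /weight !mxE /= mulr1 mulr0 expr0n /= addr0 ger0_norm//.
    by rewrite divff.
  by apply: row4P; rewrite !mxE /= ?mulr1 ?divff ?mulr0// expr0n /= !mulr0.
(* Approach along the y-axis, where the weight is 1/(k+1)^2. The limit lies on the side of the
   Z-axis given by the sign of b02; the linear span supplies the other side. *)
have SZ : secant_limits f (vec4 0 0 (b 0 2) 0).
  apply: (secant_limits_leading _ (fun k => k.+1%:R ^+ 2) _
    (cvg_harmonic_line (delta_mx 0 1))) => // k.
    rewrite /weight !mxE /= mulr1 mulr0 normr0 add0r -exprMn divff//.
    by rewrite expr1n.
  apply: row4P; rewrite !mxE /= ?mulr1 ?mulr0//.
  by rewrite mulrCA -exprMn divff// expr1n mulr1.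
have -> : vec4 x 0 z 0 = x *: vec4 1 0 0 0 + (z / b 0 2) *: vec4 0 0 (b 0 2) 0.
  by apply: row4P; rewrite !mxE /=; field.
exact: lin_span2.
Qed.

(** * The height function along the Y-axis *)

Lemma height_vec4 (v2 : R) :
  height f (vec4 0 v2 0 0) = line v2 \o (row_coord 1 \o f).
Proof.
apply/funext => q; rewrite /height dot4 !vec4E /line /row_coord /=.
by rewrite /GRing.scale /=; ring.
Qed.

Lemma dpart_height (v2 : R) :
  smooth_germ (height f (vec4 0 v2 0 0)) /\
  forall s, dpart s (height f (vec4 0 v2 0 0)) 0 = dpart s f 0 0 1 * v2.
Proof.
have [s1 d1] := smooth_lin (row_coord_continuous 1) (proj1 smooth_corank1).
have [s2 d2] := smooth_lin (line_continuous v2) s1.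
by rewrite height_vec4; split=> // s; rewrite d2 d1.
Qed.

(** The second-order part of the Y component is xy, so the Hessian matrix is v2 times the
    antidiagonal matrix of ones: a saddle when v2 != 0. *)
Lemma hessian_height (v2 : R) :
  \det (hessian (height f (vec4 0 v2 0 0))) = - v2 ^+ 2.
Proof.
have [_ D] := dpart_height v2.
by rewrite det_mx22 !mxE !D !dpart2_corank1 !vec4E /=; ring.
Qed.

Lemma singularity_A1_height (v2 : R) : v2 != 0 ->
  singularity_A1 (height f (vec4 0 v2 0 0)).
Proof.
move=> v20; have [sh D] := dpart_height v2; split=> //.
  by move=> i; rewrite D dpart1_corank1 mxE vec4E mulr0 mul0r.
by rewrite hessian_height oppr_eq0 sqrf_eq0.
Qed.

End Corank1.

(** * Contact with the model surface *)

Section Contact.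
Context {R : realType}.

Lemma g3E : @g3 R = row_coord 1. Proof. by []. Qed.

Lemma submersion_g3 : submersion_germ (@g3 R).
Proof.
have cL : continuous (row_coord 1 : 'rV[R]_4 -> R) by exact: row_coord_continuous.
rewrite g3E; split; [exact: smooth_linear|by rewrite /row_coord mxE|].
move=> t; exists (t *: delta_mx 0 1).
by rewrite diff_lin// linearZ /= /row_coord mxE; exact: mulr1.
Qed.

(** The contact map is the standard saddle xy, whose Hessian is read off from the monomial
    formulas. *)
Lemma contact_g3E : contact_map (@g3 R) = mono 1 1.
Proof. by apply/funext => q; rewrite /contact_map /g3 /= vec4E. Qed.

Lemma hessian_contact_g3 : \det (hessian (contact_map (@g3 R))) = -1.
Proof. by rewrite contact_g3E det_mx22 !mxE !dpart2_mono /=; ring. Qed.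

Lemma singularity_A1_contact_g3 : singularity_A1 (contact_map (@g3 R)).
Proof.
split; last by rewrite hessian_contact_g3 oppr_eq0 oner_eq0.
  by rewrite contact_g3E; exact: (proj1 (flat_mono 1 1)).
by move=> i; rewrite contact_g3E dpart1_mono; case: ifP.
Qed.

End Contact.

Theorem proposition4p10 (R : realType) (b c : nat -> nat -> R) (h : R -> R)
    (rem : 'rV[R]_2 -> 'rV[R]_4) (v2 : R)
    (hbc : b 0%N 2%N * c 0%N 3%N != 0)
    (h_smooth : smooth_germ1 h) (h_order : order_ge1 4 h)
    (rem_smooth : smooth_germ rem) (rem_order : order_ge 4 rem)
    (v_sphere : enorm (vec4 0 v2 0 0) = 1) (v2_neq0 : v2 != 0) :
  let f := corank1_param b c h rem in
  let v := vec4 0 v2 0 0 in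
  [/\ tangent_cone f = @XZ_plane R /\ tangent_cone f `<=` hyperplane v,
      E_plane f = @YZ_plane R /\ transverse (hyperplane v) (E_plane f),
      singularity_A1 (height f v),
      submersion_germ (@g3 R)
    & same_A1 (height f v) (contact_map (@g3 R))].
Proof.
move=> f v; have hb : b 0%N 2%N != 0.
  by move: hbc; rewrite mulf_eq0 negb_or => /andP[].
have TC : tangent_cone f = @XZ_plane R by exact: tangent_cone_corank1.
have EP : E_plane f = @YZ_plane R by exact: E_plane_corank1.
have A1 : singularity_A1 (height f v) by exact: singularity_A1_height.
have hyp_v (w : 'rV[R]_4) : w 0 1 = 0 -> hyperplane v w.
  by move=> w1; rewrite /hyperplane /= dot4 !vec4E w1; ring.
split.
- split; first exact: TC.
  by rewrite TC => w /XZ_planeP[w1 _]; exact: hyp_v.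
- split; first exact: EP.
  (* The Y-axis lies in E_p and is complementary to the hyperplane, so the Y component of w is split
     off. *)
  move=> w; exists (vec4 (w 0 0) 0 (w 0 2) (w 0 3)), (vec4 0 (w 0 1) 0 0); split.
  + by apply: hyp_v; rewrite vec4E.
  + by rewrite EP; apply/YZ_planeP; rewrite !vec4E.
  + by apply: row4P; rewrite mxE !vec4E; ring.
- exact: A1.
- exact: submersion_g3.
- split; [exact: A1|exact: singularity_A1_contact_g3|].
  have dh := hessian_height b c h rem h_smooth h_order rem_smooth rem_order v2.
  (* The determinants - v2^2 and -1 are both negative, so both singularities are of saddle type. *)
  have sgE : Num.sg (- v2 ^+ 2) = Num.sg (-1 : R).
    by rewrite !sgrN sgr1 gtr0_sg// exprn_even_gt0.
  have dg := @hessian_contact_g3 R.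
  exact: etrans (congr1 Num.sg dh) (etrans sgE (esym (congr1 Num.sg dg))).
Qed.
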